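(* Let $(A,\mathfrak{m})$ be a Noetherian local ring with $\operatorname{depth}A\ge 2$ and let $\mathfrak{a}$ be an $\mathfrak{m}$-primary ideal of $A$. Let $M$ be a finitely generated $A$-module and let $\mathcal{G}=\{\mathcal{G}_n\}_{n\in\mathbb{Z}}$ be an $\mathfrak{a}$-stable filtration on $M$ with $\mathcal{G}_n=M$ for $n\le 0$ and $\mathcal{G}_1\ne M$. Assume further that there exists $x\in\mathfrak{a}\setminus\mathfrak{a}^2$ such that its initial form $x^*\in\mathfrak{a}/\mathfrak{a}^2$ is $G_{\mathfrak{a}}(A)$-regular. Then for every $l\ge 1$ there is an isomorphism of $\mathcal{R}_{\mathfrak{a}^l}(A)$-modules $${}^*\operatorname{Hom}_{\mathcal{R}_{\mathfrak{a}}(A)}\big(\mathcal{R}(\mathcal{G},M),\mathcal{R}_{\mathfrak{a}}(A)\big)^{<l>}\cong {}^*\operatorname{Hom}_{\mathcal{R}_{\mathfrak{a}^l}(A)}\big(\mathcal{R}(\mathcal{G}^{<l>},M),\mathcal{R}_{\mathfrak{a}^l}(A)\big).$$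
   Context: An $\mathfrak{a}$-filtration on a finitely generated $A$-module $M$ is a family $\mathcal{G}=\{\mathcal{G}_n\}_{n\in\mathbb{Z}}$ of submodules of $M$ with $\mathcal{G}_n\supseteq \mathcal{G}_{n+1}$ for all $n$, $\mathcal{G}_n=M$ for all $n\ll 0$, and $\mathfrak{a}\mathcal{G}_n\subseteq \mathcal{G}_{n+1}$ for all $n$. It is $\mathfrak{a}$-stable if moreover $\mathfrak{a}\mathcal{G}_n=\mathcal{G}_{n+1}$ for all $n\gg 0$. $\mathcal{R}_{\mathfrak{a}}(A)=\bigoplus_{n\in\mathbb{Z}}\mathfrak{a}^n t^n$ (with $\mathfrak{a}^n=A$ for $n\le 0$) is the extended Rees algebra, $\mathcal{R}(\mathcal{G},M)=\bigoplus_{n\in\mathbb{Z}}\mathcal{G}_n t^n$ is the extended Rees module of $\mathcal{G}$ (a finitely generated graded $\mathcal{R}_{\mathfrak{a}}(A)$-module), and $G_{\mathfrak{a}}(A)=\bigoplus_{n\ge 0}\mathfrak{a}^n/\mathfrak{a}^{n+1}$. For graded modules $U,V$ over a graded ring $R$, ${}^*\operatorname{Hom}_R(U,V)$ is the graded $R$-module whose degree $c$ component consists of the homogeneous $R$-linear maps $U\to V$ of degree $c$. For $l\ge 1$ and a graded module $E=\bigoplus_{n}E_n$, the Veronese is $E^{<l>}=\bigoplus_{n}E_{nl}$. For the filtration $\mathcal{G}$, $\mathcal{G}^{<l>}=\{\mathcal{G}_{nl}\}_{n\in\mathbb{Z}}$, which is an $\mathfrak{a}^l$-stable filtration. One identifies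 $\mathcal{R}_{\mathfrak{a}}(A)^{<l>}=\mathcal{R}_{\mathfrak{a}^l}(A)$, so Veronese modules of graded $\mathcal{R}_{\mathfrak{a}}(A)$-modules are graded $\mathcal{R}_{\mathfrak{a}^l}(A)$-modules. *)

(* Defs.v *)
From HB Require Import structures.
From mathcomp Require Import all_boot all_order all_algebra finmap.
From mathcomp Require Import monalg.
From mathcomp Require Import boolp functions.

Set Implicit Arguments.
Unset Strict Implicit.
Unset Printing Implicit Defensive.

Import Order.TTheory GRing.Theory Num.Theory.
Local Open Scope ring_scope.

(* x lies in the sum of the subsets D i (i in Z) of V. *)
Definition in_sum (V : nmodType) (D : int -> {pred V}) (x : V) : Prop :=
  exists (s : seq int) (f : int -> V),
    [/\ uniq s, forall i, f i \in D i & x = \sum_(i <- s) f i].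

Definition in_span (R : pzRingType) (V : lmodType R) (s : seq V) (x : V) : Prop :=
  exists c : nat -> R, x = \sum_(i < size s) c i *: s`_i.

Definition fin_gen (R : pzRingType) (V : lmodType R) (N : {pred V}) : Prop :=
  exists s : seq V, forall x, x \in N <-> in_span s x.

Definition smul (R : pzRingType) (V : lmodType R) (I : {pred R}) (N : {pred V}) :
    {pred V} :=
  fun x => `[< exists s : seq (R * V),
    (forall p, p \in s -> p.1 \in I /\ p.2 \in N) /\
    x = \sum_(p <- s) p.1 *: p.2 >].

Section Smul.
Variables (R : comNzRingType) (V : lmodType R).
Implicit Types (I : {pred R}) (N P : {pred V}).

Lemma smulP I N x : reflect (exists s : seq (R * V),
    (forall p, p \in s -> p.1 \in I /\ p.2 \in N) /\
    x = \sum_(p <- s) p.1 *: p.2) (x \in smul I N).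
Proof. exact: asboolP. Qed.

Lemma smul_mem I N a x : a \in I -> x \in N -> a *: x \in smul I N.
Proof.
move=> aI xN; apply/smulP; exists [:: (a, x)]; split; last by rewrite big_seq1.
by move=> p; rewrite inE => /eqP ->.
Qed.

Lemma smul0 I N : 0 \in smul I N.
Proof. by apply/smulP; exists [::]; split=> //; rewrite big_nil. Qed.

Lemma smulD I N x y : x \in smul I N -> y \in smul I N -> x + y \in smul I N.
Proof.
move=> /smulP[s [sP ->]] /smulP[t [tP ->]]; apply/smulP; exists (s ++ t).
by split=> [p|]; [rewrite mem_cat => /orP[/sP|/tP] | rewrite big_cat].
Qed.

Lemma smul_ind I N (P : V -> Prop) : P 0 ->
  (forall x y, P x -> P y -> P (x + y)) ->
  (forall a x, a \in I -> x \in N -> P (a *: x)) ->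
  forall x, x \in smul I N -> P x.
Proof.
move=> P0 PD PM _ /smulP[s [sP ->]]; rewrite big_seq.
by elim/big_ind: _ => // p /sP[pI pN]; apply: PM.
Qed.

Lemma smulZ I N r x : (forall x, x \in N -> r *: x \in N) ->
  x \in smul I N -> r *: x \in smul I N.
Proof.
move=> NZ; move: x; apply: smul_ind.
- by rewrite scaler0 smul0.
- by move=> x y xP yP; rewrite scalerDr smulD.
- by move=> a x aI xN; rewrite scalerA mulrC -scalerA smul_mem ?NZ.
Qed.

End Smul.

(* I^0 = A and I^(k+1) = I I^k, ideals being seen as submodules of A^o. *)
Fixpoint ipow (A : comNzRingType) (I : {pred A}) (n : nat) : {pred A} :=
  if n is k.+1 then (smul I (ipow I k : {pred A^o}) : {pred A^o}) else predT.

Definition ipowz (A : comNzRingType) (I : {pred A}) (n : int) : {pred A} :=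
  if n is Posz k then ipow I k else predT.

Section Ipow.
Variables (A : comNzRingType) (I : {pred A}).

Lemma ipow0 n : 0 \in ipow I n.
Proof. by case: n => // n; exact: (@smul0 _ A^o). Qed.

Lemma ipowD n x y : x \in ipow I n -> y \in ipow I n -> x + y \in ipow I n.
Proof. by case: n => // n; exact: (@smulD _ A^o). Qed.

Lemma ipowMl n r x : x \in ipow I n -> r * x \in ipow I n.
Proof.
elim: n r x => // n IHn r x; apply: (@smulZ _ A^o) => y; exact: IHn.
Qed.

Lemma ipow_mul n k x y : x \in ipow I n -> y \in ipow I k -> x * y \in ipow I (n + k).
Proof.
elim: n x => [|n IHn] x; first by move=> _; exact: ipowMl.
move=> xI yI; rewrite addSn; move: x xI.
apply: (@smul_ind _ A^o I (ipow I n)).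
- by rewrite mul0r ipow0.
- by move=> x z xP zP; rewrite mulrDl ipowD.
move=> a x aI xI; rewrite [_ * y](_ : _ = a *: (x * y : A^o)); last exact/esym/mulrA.
by apply: (@smul_mem _ A^o) => //; exact: IHn.
Qed.

Lemma ipow_sub n k x : (k <= n)%N -> x \in ipow I n -> x \in ipow I k.
Proof.
move=> /subnK <-; elim: (n - k)%N x => // {}n IHn.
apply: (@smul_ind _ A^o I (ipow I (n + k))); first exact: ipow0.
  by move=> x y; exact: ipowD.
by move=> a y _ yI; apply: ipowMl; exact: IHn.
Qed.

Lemma ipowz0 n : 0 \in ipowz I n.
Proof. by case: n => // n; exact: ipow0. Qed.

Lemma ipowzD n x y : x \in ipowz I n -> y \in ipowz I n -> x + y \in ipowz I n.
Proof. by case: n => // n; exact: ipowD. Qed.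

Lemma ipowzMl n r x : x \in ipowz I n -> r * x \in ipowz I n.
Proof. by case: n => // n; exact: ipowMl. Qed.

Lemma ipowzN n x : x \in ipowz I n -> - x \in ipowz I n.
Proof. by rewrite -mulN1r; exact: ipowzMl. Qed.

Lemma ipowz_sub n k x : k <= n -> x \in ipowz I n -> x \in ipowz I k.
Proof. by case: n k => [n|n] [k|k] //; exact: ipow_sub. Qed.

Lemma ipowz_mul n k x y : x \in ipowz I n -> y \in ipowz I k ->
  x * y \in ipowz I (n + k).
Proof.
case: n => [n|n]; case: k => [k|k] //= xI yI.
- exact: ipow_mul.
- by apply: (@ipowz_sub n); [rewrite gerDl | rewrite mulrC; exact: ipowzMl].
- by apply: (@ipowz_sub k); [rewrite gerDr | exact: ipowzMl].
Qed.

End Ipow.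

Lemma ipowM (A : comNzRingType) (I : {pred A}) l n :
  ipow (ipow I l) n =i ipow I (n * l).
Proof.
move=> x; apply/idP/idP.
  elim: n x => // n IHn; rewrite mulSn.
  apply: (@smul_ind _ A^o (ipow I l) (ipow (ipow I l) n)).
  - exact: ipow0.
  - by move=> x y; exact: ipowD.
  - by move=> a y aI yI; apply: ipow_mul => //; exact: IHn.
elim: n x => // n IHn x; rewrite mulSn.
suff H k : (k <= l)%N -> forall x, x \in ipow I (k + n * l) ->
    x \in (smul (ipow I k) (ipow I (n * l) : {pred A^o})).
  move=> /(H _ (leqnn l)); move: x.
  apply: (@smul_ind _ A^o (ipow I l) (ipow I (n * l))); first exact: ipow0.
    by move=> x y; exact: ipowD.
  by move=> a y aI yI; apply: (@smul_mem _ A^o) => //; exact: IHn.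
elim: k => [_|k IHk lk] {}x xI.
  rewrite -[x](@scale1r _ A^o).
  exact: (@smul_mem _ A^o (ipow I 0) (ipow I (n * l)) 1 x).
move: x xI; apply: (@smul_ind _ A^o I (ipow I (k + n * l))).
    exact: (@smul0 _ A^o).
  by move=> x y; exact: (@smulD _ A^o).
move=> a y aI /(IHk (ltnW lk)); move: y.
apply: (@smul_ind _ A^o (ipow I k) (ipow I (n * l))).
- by rewrite scaler0; exact: (@smul0 _ A^o).
- by move=> y z yP zP; rewrite scalerDr; exact: (@smulD _ A^o).
move=> b y bI yI; rewrite scalerA; apply: (@smul_mem _ A^o) => //.
exact: (@smul_mem _ A^o).
Qed.

Lemma ipowzM (A : comNzRingType) (I : {pred A}) (l : nat) (n : int) :
  (0 < l)%N -> ipowz (ipow I l) n =i ipowz I (n * l%:Z).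
Proof.
move=> l0 x; case: n => n; first exact: ipowM.
by rewrite NegzE mulNr -PoszM; case: l l0.
Qed.

(* V[t, 1/t]: u : laurent V stands for the sum over n of u@_n t^n. *)
Definition laurent (V : zmodType) : Type := {malg V[int]}.

HB.instance Definition _ (V : zmodType) := GRing.Zmodule.on (laurent V).

Lemma laurent_ind (V : zmodType) (P : laurent V -> Prop) :
  (forall n x, P << x *g n >>) -> (forall f g, P f -> P g -> P (f + g)) ->
  forall f, P f.
Proof.
move=> PU PD f; rewrite [f]monalgE; elim/big_ind: _ => //.
by rewrite -(monalgU0 0).
Qed.

Section Conv.
Variables (A : comNzRingType) (V : lmodType A).
Implicit Types (f g : laurent A) (u v : laurent V).

(* The product of A[t, 1/t] on V[t, 1/t]; << x *g n >> is the monomial x t^n. *)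
Definition conv f u : laurent V :=
  \sum_(i <- msupp f) \sum_(j <- msupp u) << f@_i *: u@_j *g i + j >>.

Lemma conv_widen (d1 d2 : {fset int}) f u :
  (msupp f `<=` d1)%fset -> (msupp u `<=` d2)%fset ->
  conv f u = \sum_(i <- d1) \sum_(j <- d2) << f@_i *: u@_j *g i + j >>.
Proof.
move=> le1 le2; rewrite /conv (big_fset_incl _ le1) /=.
  apply/eq_bigr => i _; apply/big_fset_incl => // j _ /mcoeff_outdom ->.
  by rewrite scaler0 monalgU0.
move=> i _ /mcoeff_outdom fi.
by rewrite big1 // => j _; rewrite fi scale0r monalgU0.
Qed.

Lemma convDl f g u : conv (f + g) u = conv f u + conv g u.
Proof.
pose d := (msupp f `|` msupp g)%fset.
rewrite (@conv_widen d (msupp u) f) ?fsubsetUl //.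
rewrite (@conv_widen d (msupp u) g) ?fsubsetUr //.
rewrite (@conv_widen d (msupp u) (f + g)) ?msuppD_le //.
rewrite -big_split; apply: eq_bigr => i _; rewrite -big_split.
by apply: eq_bigr => j _; rewrite mcoeffD scalerDl monalgUD.
Qed.

Lemma convDr f u v : conv f (u + v) = conv f u + conv f v.
Proof.
pose d := (msupp u `|` msupp v)%fset.
rewrite (@conv_widen (msupp f) d f u) ?fsubsetUl //.
rewrite (@conv_widen (msupp f) d f v) ?fsubsetUr //.
rewrite (@conv_widen (msupp f) d f (u + v)) ?msuppD_le //.
rewrite -big_split; apply: eq_bigr => i _; rewrite -big_split.
by apply: eq_bigr => j _; rewrite mcoeffD scalerDr monalgUD.
Qed.

Lemma conv0l u : conv 0 u = 0.
Proof. by rewrite /conv msupp0 big_seq_fset0. Qed.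

Lemma conv0r f : conv f 0 = 0.
Proof. by rewrite /conv big1 // => i _; rewrite msupp0 big_seq_fset0. Qed.

Lemma convUU i j a (x : V) :
  conv << a *g i >> << x *g j >> = << a *: x *g i + j >>.
Proof. by rewrite (conv_widen msuppU_le msuppU_le) !big_seq_fset1 !mcoeffUU. Qed.

Lemma conv1 u : conv << 1 *g 0 >> u = u.
Proof.
rewrite (conv_widen msuppU_le (fsubset_refl _)) big_seq_fset1 [RHS]monalgE.
by apply: eq_bigr => j _; rewrite mcoeffUU scale1r add0r.
Qed.

Lemma mcoeff_conv f u n :
  (conv f u)@_n = \sum_(i <- msupp f) f@_i *: u@_(n - i).
Proof.
rewrite /conv raddf_sum; apply: eq_bigr => i _ /=; rewrite raddf_sum /=.
under eq_bigr => j _ do rewrite mcoeffU.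
have [ju|ju] := boolP (n - i \in msupp u); last first.
  rewrite (mcoeff_outdom ju) scaler0 big1_fset // => j ju' _.
  by case: eqP => // nE; case/negP: ju; rewrite -nE addrC addKr.
rewrite (big_fsetD1 (n - i)) //= [i + _]addrC subrK eqxx big1_fset ?addr0 //.
move=> j; rewrite in_fsetD1 => /andP[jn _] _; case: eqP => // nE.
by case/eqP: jn; rewrite -nE addrC addKr.
Qed.

End Conv.

Lemma convA (A : comNzRingType) (V : lmodType A) (f g : laurent A) (u : laurent V) :
  conv f (conv g u) = conv (conv f (g : laurent A^o)) u.
Proof.
elim/laurent_ind: f => [i a|f f' IHf IHf']; last by rewrite !convDl IHf IHf'.
elim/laurent_ind: g => [j b|g g' IHg IHg'].
  elim/laurent_ind: u => [k x|u u' IHu IHu']; last by rewrite !convDr IHu IHu'.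
  by rewrite !convUU scalerA addrA.
by rewrite !(convDl, convDr) IHg IHg'.
Qed.

Section LaurentRing.
Variable A : comNzRingType.

Definition lmul (f g : laurent A) : laurent A := conv f (g : laurent A^o).

Lemma lmulC : commutative lmul.
Proof.
move=> f g; rewrite /lmul.
elim/laurent_ind: f => [i a|f f' IHf IHf']; last by rewrite convDl convDr IHf IHf'.
elim/laurent_ind: g => [j b|g g' IHg IHg']; last by rewrite convDl convDr IHg IHg'.
by rewrite !convUU addrC; congr << _ *g _ >>; exact: mulrC.
Qed.

Lemma lmulA : associative lmul.
Proof. by move=> f g h; exact: (@convA A A^o). Qed.

Lemma lmul1 : left_id (<< 1 *g 0 >> : laurent A) lmul.
Proof. by move=> f; exact: (@conv1 A A^o). Qed.

Lemma lmulDl : left_distributive lmul +%R.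
Proof. by move=> f g h; exact: (@convDl A A^o). Qed.

Lemma lone_neq0 : (<< 1 *g 0 >> : laurent A) != 0.
Proof. by rewrite monalgU_eq0 oner_neq0. Qed.

HB.instance Definition _ := GRing.Zmodule_isComNzRing.Build (laurent A)
  lmulA lmulC lmul1 lmulDl lone_neq0.

End LaurentRing.

Lemma laurentUM (A : comNzRingType) i j (a b : A) :
  (<< a *g i >> : laurent A) * (<< b *g j >> : laurent A) = << a * b *g i + j >>.
Proof. exact: (@convUU A A^o). Qed.

Section LaurentModule.
Variables (A : comNzRingType) (V : lmodType A).

Lemma lscaleA (f g : laurent A) (u : laurent V) : conv f (conv g u) = conv (f * g) u.
Proof. exact: convA. Qed.

Lemma lscale1 : left_id 1 (@conv A V).
Proof. exact: conv1. Qed.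

Lemma lscaleDr : right_distributive (@conv A V) +%R.
Proof. exact: convDr. Qed.

Lemma lscaleDl (u : laurent V) : {morph (@conv A V)^~ u : f g / f + g}.
Proof. by move=> f g; exact: convDl. Qed.

HB.instance Definition _ := GRing.Zmodule_isLmodule.Build (laurent A) (laurent V)
  lscaleA lscale1 lscaleDr lscaleDl.

End LaurentModule.

Lemma laurentUZ (A : comNzRingType) (V : lmodType A) i j (a : A) (x : V) :
  (<< a *g i >> : laurent A) *: (<< x *g j >> : laurent V) = << a *: x *g i + j >>.
Proof. exact: convUU. Qed.

Section InSum.
Variables (V : zmodType) (D : int -> {pred V}).
Hypothesis DB : forall n, zmod_closed (D n).

Let D0 n : 0 \in D n := (DB n).1.

Let DD n x y : x \in D n -> y \in D n -> x + y \in D n.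
Proof.
move=> xD yD; rewrite -[y]opprK -[- y]add0r.
by apply: (DB n).2 => //; apply: (DB n).2.
Qed.

Lemma in_sum1 n x : x \in D n -> in_sum D x.
Proof.
move=> xD; exists [:: n], (fun i => if i == n then x else 0); split=> // [i|].
  by case: eqP => // ->.
by rewrite big_seq1 eqxx.
Qed.

Lemma in_sum0 : in_sum D 0.
Proof. exact: (@in_sum1 0). Qed.

Lemma in_sumD x y : in_sum D x -> in_sum D y -> in_sum D (x + y).
Proof.
move=> [s [f [us fD ->]]] [t [g [ut gD ->]]].
pose h (r : seq int) (k : int -> V) i := if i \in r then k i else 0.
have hD r k : (forall i, k i \in D i) -> forall i, h r k i \in D i.
  by move=> kD i; rewrite /h; case: ifP.
have hE r r' k : uniq r -> uniq r' -> {subset r <= r'} ->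
    \sum_(i <- r) k i = \sum_(i <- r') h r k i.
  move=> ur ur' rr'; rewrite /h -big_mkcond -big_filter /=.
  apply: perm_big; apply: uniq_perm => //; first exact: filter_uniq.
  by move=> i; rewrite mem_filter; case: (boolP (i \in r)) => // /rr'.
exists (undup (s ++ t)), (fun i => h s f i + h t g i).
rewrite undup_uniq; split=> // [i|]; first by apply: DD; exact: hD.
rewrite big_split; congr (_ + _); apply: hE; rewrite ?undup_uniq // => i.
  by rewrite mem_undup mem_cat => ->.
by rewrite mem_undup mem_cat orbC => ->.
Qed.

Lemma in_sumN x : in_sum D x -> in_sum D (- x).
Proof.
move=> [s [f [us fD ->]]]; exists s, (fun i => - f i); split=> // [i|].
  by rewrite -sub0r; apply: (DB i).2.
by rewrite sumrN.
Qed.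

Lemma in_sum_closed : zmod_closed (fun x => `[< in_sum D x >]).
Proof.
split; first by apply/asboolP; exact: in_sum0.
by move=> x y /asboolP xD /asboolP yD; apply/asboolP/in_sumD/in_sumN.
Qed.

End InSum.

Lemma in_sum_ind (V : nmodType) (D : int -> {pred V}) (P : V -> Prop) :
  P 0 -> (forall x y, P x -> P y -> P (x + y)) ->
  (forall n x, x \in D n -> P x) -> forall x, in_sum D x -> P x.
Proof.
move=> P0 PD PU _ [s [f [_ fD ->]]]; elim/big_ind: _ => // i _; exact: PU (fD i).
Qed.

HB.mixin Record isGraded V of GRing.Zmodule V := {
  hdeg : int -> {pred V};
  hdeg_closed : forall n, zmod_closed (hdeg n);
  hdeg_sum : forall x, in_sum hdeg x;
  hdeg_direct : forall (s : seq int) (f : int -> V), uniq s ->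
    (forall n, f n \in hdeg n) -> \sum_(n <- s) f n = 0 ->
    forall n, n \in s -> f n = 0
}.

#[short(type="gradedType")]
HB.structure Definition Graded := {V of GRing.Zmodule V & isGraded V}.

HB.mixin Record isGradedRing R of GRing.ComNzRing R & isGraded R := {
  hdeg1 : (1 : R) \in hdeg 0;
  hdegM : forall i j (x y : R), x \in hdeg i -> y \in hdeg j -> x * y \in hdeg (i + j)
}.

#[short(type="gradedRingType")]
HB.structure Definition GradedRing :=
  {R of GRing.ComNzRing R & isGraded R & isGradedRing R}.

HB.mixin Record isGradedModule (R : gradedRingType) V
    of GRing.Lmodule R V & isGraded V := {
  hdegZ : forall i j (a : R) (x : V),
    a \in hdeg i -> x \in hdeg j -> a *: x \in hdeg (i + j)
}.

#[short(type="gradedModType")]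
HB.structure Definition GradedModule (R : gradedRingType) :=
  {V of GRing.Lmodule R V & isGraded V & isGradedModule R V}.

HB.instance Definition _ (R : gradedRingType) := isGraded.Build R^o
  (@hdeg_closed R) (@hdeg_sum R) (@hdeg_direct R).
HB.instance Definition _ (R : gradedRingType) := isGradedModule.Build R R^o
  (@hdegM R).

Section StarHom.
Variables (R : gradedRingType) (U V : gradedModType R).

Definition homog_map (c : int) : {pred U -> V} := fun phi =>
  `[< linear phi /\ forall n u, u \in hdeg n -> phi u \in hdeg (n + c) >].

(* *Hom is realised inside Hom_R(U, V) as the sum over c of the groups of     *)
(* homogeneous linear maps of degree c; this sum is direct (hdeg_direct).     *)
Definition star_hom_pred : {pred U -> V} := fun phi => `[< in_sum homog_map phi >].

Record star_hom := StarHom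
  { star_hom_val :> U -> V; star_homP : star_hom_val \in star_hom_pred }.

HB.instance Definition _ := [isSub for star_hom_val].
HB.instance Definition _ := [Choice of star_hom by <:].

Lemma homog_mapP c phi : reflect
  (linear phi /\ forall n u, u \in hdeg n -> phi u \in hdeg (n + c))
  (phi \in homog_map c).
Proof. exact: asboolP. Qed.

Lemma homog_map_closed c : zmod_closed (homog_map c).
Proof.
split.
  apply/homog_mapP; split=> [a u v|n u _]; first by rewrite /GRing.zero /= scaler0 addr0.
  exact: (hdeg_closed _).1.
move=> f g /homog_mapP[fL fc] /homog_mapP[gL gc]; apply/homog_mapP; split.
  move=> a u v; rewrite !fctE fL gL scalerBr.
  by rewrite opprD addrACA.
by move=> n u un; rewrite !fctE; apply: (hdeg_closed _).2; [exact: fc|exact: gc].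
Qed.

Lemma homog_mapZ i c (a : R) phi : a \in hdeg i -> phi \in homog_map c ->
  a *: phi \in homog_map (i + c).
Proof.
move=> ai /homog_mapP[fL fc]; apply/homog_mapP; split.
  by move=> b u v; rewrite !fctE fL scalerDr !scalerA [a * b]mulrC.
by move=> n u un; rewrite !fctE addrCA; apply: hdegZ => //; exact: fc.
Qed.

Lemma star_hom_closed : subsemimod_closed star_hom_pred.
Proof.
have [S0 SB] := in_sum_closed homog_map_closed.
have SD : {in star_hom_pred &, forall f g, f + g \in star_hom_pred}.
  by move=> f g /asboolP fS /asboolP gS; apply/asboolP/(in_sumD homog_map_closed).
split=> // a f /asboolP fS; have := hdeg_sum a.
move: a; apply: in_sum_ind => [|a b aS bS|i a ai].
- by rewrite scale0r.
- by rewrite scalerDl SD.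
move: f fS; apply: in_sum_ind => [|f g fS gS|c f fc].
- by rewrite scaler0.
- by rewrite scalerDr SD.
by apply/asboolP; apply: (in_sum1 homog_map_closed); exact: homog_mapZ ai fc.
Qed.

HB.instance Definition _ := GRing.isSubmodClosed.Build R (U -> V) star_hom_pred
  star_hom_closed.
HB.instance Definition _ := [SubChoice_isSubLmodule of star_hom by <:].

Definition star_hom_deg (c : int) : {pred star_hom} :=
  fun phi => val phi \in homog_map c.

Lemma star_hom_linear (phi : star_hom) : linear phi.
Proof.
case: phi => phi /= /asboolP; move: phi; apply: in_sum_ind.
- by move=> a u v; rewrite /GRing.zero /= scaler0 addr0.
- by move=> f g fL gL a u v; rewrite !fctE fL gL scalerDr addrACA.
- by move=> c f /homog_mapP[].
Qed.

Lemma star_hom_deg_closed c : zmod_closed (star_hom_deg c).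
Proof.
have [H0 HB] := homog_map_closed c; split; first exact: H0.
by move=> f g fc gc; rewrite /in_mem /= /star_hom_deg raddfB; exact: HB.
Qed.

Lemma star_hom_deg_sum phi : in_sum star_hom_deg phi.
Proof.
have /asboolP[s [f [us fD fE]]] := star_homP phi.
have fS c : f c \in star_hom_pred.
  by apply/asboolP; apply: (in_sum1 homog_map_closed); exact: fD.
exists s, (fun c => StarHom (fS c)); split=> //.
by apply: val_inj; rewrite raddf_sum.
Qed.

Lemma star_hom_deg_direct (s : seq int) (f : int -> star_hom) : uniq s ->
  (forall n, f n \in star_hom_deg n) -> \sum_(n <- s) f n = 0 ->
  forall n, n \in s -> f n = 0.
Proof.
move=> us fD f0 c cs; apply: val_inj; apply/funext => u.
have fA v w : val (f c) (v + w) = val (f c) v + val (f c) w.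
  by have /= := star_hom_linear (f c) 1 v w; rewrite !scale1r.
have := hdeg_sum u; move: u; apply: in_sum_ind => [|u v uS vS|n u un].
- by apply: (addrI (val (f c) 0)); rewrite -fA !addr0.
- by rewrite fA uS vS addr0.
have H := @hdeg_direct V [seq n + i | i <- s] (fun k => val (f (k - n)) u).
have -> : c = n + c - n by rewrite addrC addKr.
apply: H; last exact: map_f.
- by rewrite map_inj_uniq //; exact: addrI.
- move=> k; have /homog_mapP[_ /(_ n u un)] : val (f (k - n)) \in homog_map (k - n) by exact: fD.
  by rewrite [n + _]addrC subrK.
rewrite big_map; under eq_bigr => i _ do rewrite [n + i]addrC addrK.
have := congr1 (fun phi : star_hom => val phi u) f0; rewrite raddf_sum /= => fu0.
by rewrite -[RHS]fu0; elim/big_rec2: _ => // i y z _ ->.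
Qed.

HB.instance Definition _ := isGraded.Build star_hom
  star_hom_deg_closed star_hom_deg_sum star_hom_deg_direct.

Lemma star_hom_degZ i j (a : R) (phi : star_hom) :
  a \in hdeg i -> phi \in hdeg j -> a *: phi \in hdeg (i + j).
Proof. by move=> ai phij; exact: homog_mapZ. Qed.

HB.instance Definition _ := isGradedModule.Build R star_hom star_hom_degZ.

End StarHom.

Definition veronese_pred (l : nat) (V : gradedType) : {pred V} :=
  fun x => `[< in_sum (fun n => hdeg (n * l%:Z)) x >].
Arguments veronese_pred : clear implicits.

Section Veronese.
Variable l : nat.

Lemma ver_closed (V : gradedType) : zmod_closed (veronese_pred l V).
Proof. exact: (in_sum_closed (fun n => hdeg_closed (n * l%:Z))). Qed.

Lemma ver_ind (V : gradedType) (P : V -> Prop) :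
  P 0 -> (forall x y, P x -> P y -> P (x + y)) ->
  (forall n x, x \in hdeg (n * l%:Z) -> P x) -> forall x, x \in veronese_pred l V -> P x.
Proof. by move=> P0 PD PU x /asboolP; exact: in_sum_ind. Qed.

Lemma ver_hdeg (V : gradedType) n (x : V) : x \in hdeg (n * l%:Z) -> x \in veronese_pred l V.
Proof.
move=> xn; apply/asboolP.
exact: (in_sum1 (fun n => hdeg_closed (n * l%:Z))) xn.
Qed.

Lemma verD (V : gradedType) (x y : V) :
  x \in veronese_pred l V -> y \in veronese_pred l V -> x + y \in veronese_pred l V.
Proof.
move=> /asboolP xV /asboolP yV; apply/asboolP.
exact: (in_sumD (fun n => hdeg_closed (n * l%:Z))).
Qed.

Lemma verM (R : gradedRingType) (x y : R) :
  x \in veronese_pred l R -> y \in veronese_pred l R -> x * y \in veronese_pred l R.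
Proof.
move=> xR yR; move: x xR; apply: ver_ind => [|x x' xP x'P|i x xi].
- by rewrite mul0r; exact: (ver_closed _).1.
- by rewrite mulrDl verD.
move: y yR; apply: ver_ind => [|y y' yP y'P|j y yj].
- by rewrite mulr0; exact: (ver_closed _).1.
- by rewrite mulrDr verD.
by apply: (@ver_hdeg _ (i + j)); rewrite mulrDl; exact: hdegM.
Qed.

Lemma verZ (R : gradedRingType) (V : gradedModType R) (a : R) (x : V) :
  a \in veronese_pred l R -> x \in veronese_pred l V -> a *: x \in veronese_pred l V.
Proof.
move=> aR xV; move: a aR; apply: ver_ind => [|a b aP bP|i a ai].
- by rewrite scale0r; exact: (ver_closed _).1.
- by rewrite scalerDl verD.
move: x xV; apply: ver_ind => [|y y' yP y'P|j y yj].
- by rewrite scaler0; exact: (ver_closed _).1.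
- by rewrite scalerDr verD.
by apply: (@ver_hdeg _ (i + j)); rewrite mulrDl; exact: hdegZ.
Qed.

End Veronese.

Section VeroneseRing.
Variables (l : nat) (R : gradedRingType).

Record veronese_ring := VerR { verR_val :> R; verRP : verR_val \in veronese_pred l R }.

HB.instance Definition _ := [isSub for verR_val].
HB.instance Definition _ := [Choice of veronese_ring by <:].

Lemma verR_closed : subring_closed (veronese_pred l R).
Proof.
split; last by move=> x y; exact: verM.
  by apply: (@ver_hdeg _ _ 0); rewrite mul0r; exact: hdeg1.
exact: (ver_closed l R).2.
Qed.

HB.instance Definition _ := GRing.isSubringClosed.Build R (veronese_pred l R) verR_closed.
HB.instance Definition _ := [SubChoice_isSubComNzRing of veronese_ring by <:].

End VeroneseRing.

Section VeroneseModule.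
Variables (l : nat) (R : gradedRingType) (V : gradedModType R).

Record veronese := Ver { ver_val :> V; verP : ver_val \in veronese_pred l V }.

HB.instance Definition _ := [isSub for ver_val].
HB.instance Definition _ := [Choice of veronese by <:].
HB.instance Definition _ := GRing.SubChoice_isSubZmodule.Build V (veronese_pred l V) veronese
  (ver_closed l V).

Definition ver_scale (a : veronese_ring l R) (x : veronese) : veronese :=
  Ver (verZ (verRP a) (verP x)).

Lemma ver_scaleA a b x : ver_scale a (ver_scale b x) = ver_scale (a * b) x.
Proof. by apply: val_inj; rewrite /= scalerA. Qed.

Lemma ver_scale1 : left_id 1 ver_scale.
Proof. by move=> x; apply: val_inj; rewrite /= scale1r. Qed.

Lemma ver_scaleDr : right_distributive ver_scale +%R.
Proof. by move=> a x y; apply: val_inj; rewrite /= scalerDr. Qed.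

Lemma ver_scaleDl x : {morph ver_scale^~ x : a b / a + b}.
Proof. by move=> a b; apply: val_inj; rewrite /= scalerDl. Qed.

HB.instance Definition _ := GRing.Zmodule_isLmodule.Build (veronese_ring l R) veronese
  ver_scaleA ver_scale1 ver_scaleDr ver_scaleDl.

End VeroneseModule.

Definition restrict_scalars (S R : comNzRingType) (iota : {rmorphism S -> R})
    (V : lmodType R) : Type := V.

Section Restr.
Variables (S R : comNzRingType) (iota : {rmorphism S -> R}) (V : lmodType R).

HB.instance Definition _ := GRing.Zmodule.copy (restrict_scalars iota V) V.

Definition restr_scale (a : S) (x : restrict_scalars iota V) : restrict_scalars iota V :=
  iota a *: (x : V).

Lemma restr_scaleA a b x : restr_scale a (restr_scale b x) = restr_scale (a * b) x.
Proof. by rewrite /restr_scale scalerA rmorphM. Qed.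

Lemma restr_scale1 : left_id 1 restr_scale.
Proof. by move=> x; rewrite /restr_scale rmorph1 scale1r. Qed.

Lemma restr_scaleDr : right_distributive restr_scale +%R.
Proof. by move=> a x y; rewrite /restr_scale -scalerDr. Qed.

Lemma restr_scaleDl x : {morph restr_scale^~ x : a b / a + b}.
Proof. by move=> a b; rewrite /restr_scale rmorphD scalerDl. Qed.

HB.instance Definition _ := GRing.Zmodule_isLmodule.Build S (restrict_scalars iota V)
  restr_scaleA restr_scale1 restr_scaleDr restr_scaleDl.

End Restr.

Record filtration (A : comNzRingType) (I : {pred A}) (M : lmodType A) := Filtration {
  fil :> int -> submodClosed M;
  fil_dec : forall n, {subset fil (n + 1) <= fil n};
  fil_low : exists n0, forall n, n <= n0 -> fil n =i predT;
  fil_smul : forall n, {subset smul I (fil n) <= fil (n + 1)}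
}.

Definition stable (A : comNzRingType) (I : {pred A}) (M : lmodType A)
    (G : filtration I M) : Prop :=
  exists n0, forall n, n0 <= n -> smul I (G n) =i G (n + 1).

Section Filtration.
Variables (A : comNzRingType) (I : {pred A}) (M : lmodType A) (G : filtration I M).

Lemma fil_sub n k : k <= n -> {subset G n <= G k}.
Proof.
move=> kn; have -> : n = k + `|n - k|%:Z by rewrite gez0_abs ?subr_ge0 // [k + _]addrC subrK.
elim: `|n - k|%N => [|d IHd] x; first by rewrite addr0.
by rewrite -addn1 PoszD addrA => /fil_dec; exact: IHd.
Qed.

Lemma fil_ipowz n k a x : a \in ipowz I n -> x \in G k -> a *: x \in G (n + k).
Proof.
case: n => n; last by move=> _ xG; apply: rpredZ; apply: fil_sub xG; rewrite gerDr.
elim: n a k => [|n IHn] a k; first by move=> _ xG; rewrite add0r rpredZ.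
move=> aI xG; move: a aI; apply: (@smul_ind _ A^o I (ipow I n)).
- by rewrite scale0r rpred0.
- by move=> a b aP bP; rewrite scalerDl rpredD.
move=> a b aI bI; rewrite [a *: b]/(a * b) -scalerA.
have -> : n.+1%:Z + k = n%:Z + k + 1 by rewrite -addn1 PoszD addrAC.
by apply: fil_smul; apply: smul_mem => //; exact: IHn.
Qed.

Section VeroneseFiltration.
Variables (l : nat) (l0 : (0 < l)%N).

Lemma verF_dec n : {subset G ((n + 1) * l%:Z) <= G (n * l%:Z)}.
Proof. by apply: fil_sub; rewrite mulrDl lerDl. Qed.

Lemma verF_low : exists n0, forall n, n <= n0 -> G (n * l%:Z) =i predT.
Proof.
have [n0 Gn0] := fil_low G; exists (- `|n0|%:Z) => n nn0; apply: Gn0.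
have n_le0 : n <= 0 by apply: le_trans nn0 _; rewrite oppr_le0.
apply: (@le_trans _ _ n); last by apply: le_trans nn0 _; rewrite abszE lerNnormlW.
by rewrite -{2}[n]mulr1 ler_wnM2l.
Qed.

Lemma verF_smul n :
  {subset smul (ipow I l) (G (n * l%:Z)) <= G ((n + 1) * l%:Z)}.
Proof.
apply: smul_ind => [|x y xG yG|a x aI xG]; [exact: rpred0 | exact: rpredD |].
by rewrite mulrDl mul1r addrC; exact: (@fil_ipowz (Posz l)).
Qed.

Definition veronese_fil : filtration (ipow I l) M :=
  @Filtration A (ipow I l) M (fun n => G (n * l%:Z)) verF_dec verF_low verF_smul.

End VeroneseFiltration.
End Filtration.

(* The direct sum of the D_n t^n inside V[t, 1/t]. *)
Definition coef_in (V : zmodType) (D : int -> {pred V}) : {pred laurent V} :=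
  fun u => `[< forall n, (u : {malg V[int]})@_n \in D n >].

Lemma coef_inP (V : zmodType) (D : int -> {pred V}) (u : laurent V) :
  reflect (forall n, u@_n \in D n) (u \in coef_in D).
Proof. exact: asboolP. Qed.

Lemma coef_in_closed (V : zmodType) (D : int -> {pred V}) :
  (forall n, zmod_closed (D n)) -> zmod_closed (coef_in D).
Proof.
move=> DB; split; first by apply/coef_inP => n; rewrite mcoeff0 (DB n).1.
move=> u v /coef_inP uD /coef_inP vD; apply/coef_inP => n.
by rewrite mcoeffB; apply: (DB n).2.
Qed.

Lemma coef_inU (V : zmodType) (D : int -> {pred V}) n x :
  (forall k, 0 \in D k) -> x \in D n -> << x *g n >> \in coef_in D.
Proof.
by move=> D0 xD; apply/coef_inP => k; rewrite mcoeffU; case: eqP => [<-|].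
Qed.

Lemma ipowz_closed (A : comNzRingType) (I : {pred A}) n : zmod_closed (ipowz I n).
Proof. by split; [exact: ipowz0 | move=> x y xI yI; exact/ipowzD/ipowzN]. Qed.

Section Rees.
Variables (A : comNzRingType) (I : {pred A}).

Record ext_rees := Rees
  { rees_val :> laurent A; reesP : rees_val \in coef_in (ipowz I) }.

HB.instance Definition _ := [isSub for rees_val].
HB.instance Definition _ := [Choice of ext_rees by <:].

Lemma rees_closed : subring_closed (coef_in (ipowz I)).
Proof.
split; first by apply: coef_inU => // k; exact: ipowz0.
  exact: (coef_in_closed (ipowz_closed I)).2.
move=> f g /coef_inP fI /coef_inP gI; apply/coef_inP => n.
rewrite (@mcoeff_conv A A^o); elim/big_ind: _ => [|x y|i _]; first exact: ipowz0.
  exact: ipowzD.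
by rewrite -[n in ipowz _ n](subrK i) [_ + i]addrC; exact: ipowz_mul.
Qed.

HB.instance Definition _ := GRing.SubChoice_isSubComNzRing.Build (laurent A)
  (coef_in (ipowz I)) ext_rees rees_closed.

Definition reesU (n : int) (a : A) (aI : a \in ipowz I n) : ext_rees :=
  Rees (coef_inU (ipowz0 I) aI).

End Rees.

Section MonomialGrading.
Variables (V : zmodType) (U : zmodType) (v : {additive U -> laurent V}).
Hypothesis v_inj : injective v.

Definition monom_deg (n : int) : {pred U} := fun u => v u == << (v u)@_n *g n >>.

Lemma monom_degP n u : reflect (exists x, v u = << x *g n >>) (u \in monom_deg n).
Proof.
apply: (iffP eqP) => [->|[x ->]]; first by eexists.
by rewrite mcoeffUU.
Qed.

Lemma monom_deg_closed n : zmod_closed (monom_deg n).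
Proof.
split; first by apply/monom_degP; exists 0; rewrite raddf0 monalgU0.
move=> f g /monom_degP[x fx] /monom_degP[y gy]; apply/monom_degP; exists (x - y).
by rewrite raddfB fx gy monalgUB.
Qed.

Lemma monom_deg_direct (s : seq int) (f : int -> U) : uniq s ->
  (forall n, f n \in monom_deg n) -> \sum_(n <- s) f n = 0 ->
  forall n, n \in s -> f n = 0.
Proof.
move=> us fD f0 n ns; apply: v_inj; rewrite raddf0.
have [x fx] := monom_degP _ _ (fD n).
have := congr1 (fun u => (v u)@_n) f0; rewrite raddf_sum raddf0 mcoeff0.
rewrite raddf_sum (bigD1_seq n) //= fx mcoeffUU big1 ?addr0 => [->|i inn].
  by rewrite monalgU0.
by have [y ->] := monom_degP _ _ (fD i); rewrite mcoeffU (negbTE inn).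
Qed.

Lemma monom_deg_sum u : (forall n, exists w, v w = << (v u)@_n *g n >>) ->
  in_sum monom_deg u.
Proof.
move=> /choice[w wE]; exists (msupp (v u)), w; split=> [|n|].
- exact: fset_uniq.
- by apply/monom_degP; exists ((v u)@_n).
by apply: v_inj; rewrite raddf_sum [LHS]monalgE; under [RHS]eq_bigr do rewrite wE.
Qed.

End MonomialGrading.

Section ReesGraded.
Variables (A : comNzRingType) (I : {pred A}).

Definition rees_deg : int -> {pred ext_rees I} :=
  monom_deg (val : ext_rees I -> laurent A).

Lemma rees_deg_sum (f : ext_rees I) : in_sum rees_deg f.
Proof.
apply: (@monom_deg_sum _ _ (val : {additive ext_rees I -> laurent A}) val_inj) => n.
by have /coef_inP fI := reesP f; exists (reesU (fI n)).
Qed.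

HB.instance Definition _ := isGraded.Build (ext_rees I)
  (@monom_deg_closed _ _ (val : {additive ext_rees I -> laurent A})) rees_deg_sum
  (@monom_deg_direct _ _ (val : {additive ext_rees I -> laurent A}) val_inj).

Lemma rees_degP n (f : ext_rees I) :
  reflect (exists a : A, val f = << a *g n >>) (f \in hdeg n).
Proof. exact: (monom_degP (val : {additive ext_rees I -> laurent A})). Qed.

Lemma rees_deg1 : (1 : ext_rees I) \in hdeg 0.
Proof. by apply/rees_degP; exists 1. Qed.

Lemma rees_degM i j (f g : ext_rees I) :
  f \in hdeg i -> g \in hdeg j -> f * g \in hdeg (i + j).
Proof.
move=> /rees_degP[x fx] /rees_degP[y gy]; apply/rees_degP; exists (x * y).
by rewrite -laurentUM -fx -gy.
Qed.

HB.instance Definition _ := isGradedRing.Build (ext_rees I) rees_deg1 rees_degM.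

End ReesGraded.

Section ReesModule.
Variables (A : comNzRingType) (I : {pred A}) (M : lmodType A) (G : filtration I M).

Definition reesM_pred : {pred laurent M} := coef_in (fun n => G n : {pred M}).

Record ext_rees_mod := ReesM
  { reesM_val :> laurent M; reesMP : reesM_val \in reesM_pred }.

HB.instance Definition _ := [isSub for reesM_val].
HB.instance Definition _ := [Choice of ext_rees_mod by <:].

Lemma reesM_closed : zmod_closed reesM_pred.
Proof.
apply: coef_in_closed => n.
by split; [exact: rpred0 | move=> x y xG yG; rewrite rpredD // -scaleN1r rpredZ].
Qed.

HB.instance Definition _ := GRing.SubChoice_isSubZmodule.Build (laurent M)
  reesM_pred ext_rees_mod reesM_closed.

Lemma reesM_scale_in (f : ext_rees I) (u : ext_rees_mod) : val f *: val u \in reesM_pred.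
Proof.
case: f u => [f /= /coef_inP fI] [u /= /coef_inP uG]; apply/coef_inP => n.
rewrite mcoeff_conv; apply: rpred_sum => i _.
by rewrite -[n in G n](subrK i) [_ + i]addrC; exact: fil_ipowz.
Qed.

Definition reesM_scale (f : ext_rees I) (u : ext_rees_mod) : ext_rees_mod :=
  ReesM (reesM_scale_in f u).

Lemma reesM_scaleA f g u : reesM_scale f (reesM_scale g u) = reesM_scale (f * g) u.
Proof. by apply: val_inj; rewrite /= scalerA. Qed.

Lemma reesM_scale1 : left_id 1 reesM_scale.
Proof. by move=> u; apply: val_inj; rewrite /= scale1r. Qed.

Lemma reesM_scaleDr : right_distributive reesM_scale +%R.
Proof. by move=> f u v; apply: val_inj; rewrite /= scalerDr. Qed.

Lemma reesM_scaleDl u : {morph reesM_scale^~ u : f g / f + g}.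
Proof. by move=> f g; apply: val_inj; rewrite /= scalerDl. Qed.

HB.instance Definition _ := GRing.Zmodule_isLmodule.Build (ext_rees I) ext_rees_mod
  reesM_scaleA reesM_scale1 reesM_scaleDr reesM_scaleDl.

Definition reesM_deg : int -> {pred ext_rees_mod} :=
  monom_deg (val : ext_rees_mod -> laurent M).

Lemma reesM_deg_sum (u : ext_rees_mod) : in_sum reesM_deg u.
Proof.
apply: (@monom_deg_sum _ _ (val : {additive ext_rees_mod -> laurent M}) val_inj) => n.
have /coef_inP uG := reesMP u.
by exists (ReesM (@coef_inU M (fun n => G n) n _ (fun k => rpred0 (G k)) (uG n))).
Qed.

HB.instance Definition _ := isGraded.Build ext_rees_mod
  (@monom_deg_closed _ _ (val : {additive ext_rees_mod -> laurent M})) reesM_deg_sum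
  (@monom_deg_direct _ _ (val : {additive ext_rees_mod -> laurent M}) val_inj).

Lemma reesM_degP n (u : ext_rees_mod) :
  reflect (exists x : M, val u = << x *g n >>) (u \in hdeg n).
Proof. exact: (monom_degP (val : {additive ext_rees_mod -> laurent M})). Qed.

Lemma reesM_degZ i j (f : ext_rees I) (u : ext_rees_mod) :
  f \in hdeg i -> u \in hdeg j -> f *: u \in hdeg (i + j).
Proof.
move=> /rees_degP[x fx] /reesM_degP[y uy]; apply/reesM_degP; exists (x *: y).
by rewrite -laurentUZ -fx -uy.
Qed.

HB.instance Definition _ := isGradedModule.Build (ext_rees I) ext_rees_mod reesM_degZ.

End ReesModule.

Section ReesVeronese.
Variables (A : comNzRingType) (I : {pred A}) (l : nat).

Definition dilate (f : laurent A) : laurent A :=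
  \sum_(i <- msupp f) << f@_i *g i * l%:Z >>.

Lemma dilate_widen (d : {fset int}) f : (msupp f `<=` d)%fset ->
  dilate f = \sum_(i <- d) << f@_i *g i * l%:Z >>.
Proof.
move=> le; rewrite /dilate (big_fset_incl _ le) //= => i _ /mcoeff_outdom ->.
by rewrite monalgU0.
Qed.

Lemma dilateU i a : dilate << a *g i >> = << a *g i * l%:Z >>.
Proof. by rewrite (dilate_widen msuppU_le) big_seq_fset1 mcoeffUU. Qed.

Lemma dilateD : {morph dilate : f g / f + g}.
Proof.
move=> f g; pose d := (msupp f `|` msupp g)%fset.
rewrite (@dilate_widen d f) ?fsubsetUl // (@dilate_widen d g) ?fsubsetUr //.
rewrite (@dilate_widen d (f + g)) ?msuppD_le // -big_split; apply: eq_bigr => i _.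
by rewrite mcoeffD monalgUD.
Qed.

Lemma dilateM : {morph dilate : f g / f * g}.
Proof.
move=> f g; elim/laurent_ind: f => [i a|f f' IHf IHf']; last first.
  by rewrite dilateD !mulrDl dilateD IHf IHf'.
elim/laurent_ind: g => [j b|g g' IHg IHg']; last first.
  by rewrite dilateD !mulrDr dilateD IHg IHg'.
by rewrite laurentUM !dilateU laurentUM mulrDl.
Qed.

Lemma dilate1 : dilate 1 = 1.
Proof. by rewrite [LHS]dilateU mul0r. Qed.

Lemma ipowz_dilate n a : a \in ipowz (ipow I l) n -> a \in ipowz I (n * l%:Z).
Proof. by case: l => [|k]; [rewrite mulr0 | rewrite ipowzM]. Qed.

Lemma dilate_in (f : ext_rees (ipow I l)) : dilate (val f) \in coef_in (ipowz I).
Proof.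
have /coef_inP fI := reesP f; apply/coef_inP => n; rewrite raddf_sum /=.
elim/big_ind: _ => [|x y|i _]; [exact: ipowz0 | exact: ipowzD |].
by rewrite mcoeffU; case: eqP => [<-|_]; [exact: ipowz_dilate (fI i) | exact: ipowz0].
Qed.

Definition rees_dilate (f : ext_rees (ipow I l)) : ext_rees I := Rees (dilate_in f).

Lemma rees_dilateD : {morph rees_dilate : f g / f + g}.
Proof. by move=> f g; apply: val_inj; exact: dilateD. Qed.

Lemma rees_dilate_ver f : rees_dilate f \in veronese_pred l (ext_rees I).
Proof.
have D0 : rees_dilate 0 = 0.
  by apply: (addrI (rees_dilate 0)); rewrite -rees_dilateD !addr0.
have := hdeg_sum f; move: f; apply: in_sum_ind.
- by rewrite D0; exact: (ver_closed _ _).1.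
- by move=> f g fV gV; rewrite rees_dilateD; exact: verD.
move=> n f /rees_degP[a fa]; apply: (@ver_hdeg _ _ n); apply/rees_degP; exists a.
by rewrite /= fa dilateU.
Qed.

(* f(t) |-> f(t^l); for l > 0 it identifies R_(I^l)(A) with R_I(A)^<l>, see   *)
(* rees_veronese_bij. *)
Definition rees_veronese (f : ext_rees (ipow I l)) : veronese_ring l (ext_rees I) :=
  VerR (rees_dilate_ver f).

Lemma rees_verB : {morph rees_veronese : f g / f - g}.
Proof.
move=> f g; apply/eqP; rewrite eq_sym subr_eq; apply/eqP; apply: val_inj.
by rewrite /= -rees_dilateD subrK.
Qed.

Lemma rees_verM : multiplicative rees_veronese.
Proof.
by split=> [f g|]; do 2 apply: val_inj; [exact: dilateM | exact: dilate1].
Qed.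

HB.instance Definition _ := GRing.isAdditive.Build (ext_rees (ipow I l))
  (veronese_ring l (ext_rees I)) rees_veronese rees_verB.
HB.instance Definition _ := GRing.isMultiplicative.Build (ext_rees (ipow I l))
  (veronese_ring l (ext_rees I)) rees_veronese rees_verM.

Lemma rees_veronese_bij : (0 < l)%N -> bijective rees_veronese.
Proof.
move=> l0; suff H g : exists f, rees_veronese f = g /\ forall f', rees_veronese f' = g -> f' = f.
  have [h hP] := choice H; exists h => [f|g]; last exact: (hP g).1.
  by symmetry; exact: (hP (rees_veronese f)).2.
have l_neq0 : l%:Z != 0 by case: l l0.
have dilE (f : laurent A) n : (dilate f)@_(n * l%:Z) = f@_n.
  elim/laurent_ind: f => [i a|f f' IHf IHf']; last by rewrite dilateD !mcoeffD IHf IHf'.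
  by rewrite dilateU !mcoeffU (inj_eq (mulIf l_neq0)).
have inj : injective rees_veronese.
  move=> f f' /(congr1 val)/(congr1 val) /= ff'; apply: val_inj; apply/malgP => n.
  by rewrite -dilE ff' dilE.
suff [f fg] : exists f, rees_veronese f = g by exists f; split=> // f' f'g; apply: inj; rewrite fg.
case: g => g gV; suff [f fg] : exists f, rees_dilate f = g.
  by exists f; apply: val_inj.
move: g gV; apply: ver_ind.
- exists 0; exact: (congr1 val (raddf0 rees_veronese)).
- by move=> _ _ [f <-] [f' <-]; exists (f + f'); exact: rees_dilateD.
move=> n g /rees_degP[a ga].
have aI : a \in ipowz (ipow I l) n.
  by rewrite ipowzM //; have /coef_inP/(_ (n * l%:Z)) := reesP g; rewrite [rees_val g]ga mcoeffUU.
by exists (reesU aI); apply: val_inj; rewrite /= dilateU ga.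
Qed.

End ReesVeronese.
Arguments rees_veronese {A} I l _.

Section AssociatedGraded.
Variables (A : comNzRingType) (a : idealr A).

Lemma ipow1 : ipow a 1 =i a.
Proof.
move=> x; apply/idP/idP; last first.
  by move=> xa; rewrite -[x]mulr1; exact: (@smul_mem _ A^o).
move: x; apply: (@smul_ind _ A^o a (ipow a 0) (fun x : A => x \in a)).
- exact: rpred0.
- by move=> y z; exact: rpredD.
- by move=> y z ya _; rewrite [y *: z]mulrC idealMr.
Qed.

Definition gr_ideal : {pred ext_rees a} :=
  fun f => `[< forall n, (val f)@_n \in ipowz a (n + 1) >].

Lemma gr_idealP (f : ext_rees a) :
  reflect (forall n, (val f)@_n \in ipowz a (n + 1)) (f \in gr_ideal).
Proof. exact: asboolP. Qed.

Lemma gr_ideal_closed : idealr_closed gr_ideal.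
Proof.
split; first by apply/gr_idealP => n; rewrite mcoeff0; exact: ipowz0.
  apply/negP => /gr_idealP/(_ 0); rewrite mcoeffUU add0r [_ \in _]ipow1.
  by rewrite idealr1.
move=> h f g /gr_idealP fI /gr_idealP gI; apply/gr_idealP => n.
have /coef_inP hI := reesP h.
have -> : (val (h * f + g))@_n =
    (conv (val h) (val f : laurent A^o))@_n + (val g)@_n by exact: mcoeffD.
apply: ipowzD => //; rewrite (@mcoeff_conv A A^o).
elim/big_ind: _ => [|x y|i _]; [exact: ipowz0 | exact: ipowzD |].
by rewrite -[n in ipowz _ (n + 1)](subrK i) [_ + i]addrC -addrA; exact: ipowz_mul.
Qed.

HB.instance Definition _ := isIdealr.Build (ext_rees a) gr_ideal gr_ideal_closed.

(* G_a(A), the direct sum of the a^n / a^(n+1), as the quotient of the direct *)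
(* sum of the a^n t^n by that of the a^(n+1) t^n; the components with n < 0   *)
(* are A / A = 0.                                                             *)
Definition assoc_graded := {ideal_quot gr_ideal}.
HB.instance Definition _ := GRing.ComNzRing.on assoc_graded.

(* The initial form x + a^2 of x in a, in the component a / a^2 of G_a(A). *)
Definition initial_form (x : A) (xa : x \in a) : assoc_graded :=
  let x1 : x \in ipowz a 1 := etrans (ipow1 x) xa in
  (\pi_({ideal_quot gr_ideal}) (reesU x1))%qT.

End AssociatedGraded.

Definition noetherian (A : comNzRingType) : Prop :=
  forall I : submodClosed A^o, fin_gen I.

Definition maximal_ideal (A : comNzRingType) (m : idealr A) : Prop :=
  forall J : idealr A, {subset m <= J} -> J =i m.

Definition local_ring (A : comNzRingType) (m : idealr A) : Prop :=
  maximal_ideal m /\ forall J : idealr A, maximal_ideal J -> J =i m.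

(* q is a primary ideal with radical m. *)
Definition m_primary (A : comNzRingType) (m q : idealr A) : Prop :=
  (forall x y, x * y \in q -> x \in q \/ exists n, y ^+ n \in q) /\
  (forall x, x \in m <-> exists n, x ^+ n \in q).

Definition regular_seq (A : comNzRingType) (s : seq A) : Prop :=
  (forall i y, (i < size s)%N ->
     in_span (take i s : seq A^o) (s`_i * y) -> in_span (take i s : seq A^o) y) /\
  ~ in_span (s : seq A^o) 1.

(* d is the maximal length of an A-regular sequence contained in m. *)
Definition has_depth (A : comNzRingType) (m : idealr A) (d : nat) : Prop :=
  (exists s : seq A, [/\ regular_seq s, {subset s <= m} & size s = d]) /\
  (forall s : seq A, regular_seq s -> {subset s <= m} -> (size s <= d)%N).

(* Main.v *)
Require Import Defs.
From HB Require Import structures.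
From mathcomp Require Import all_boot all_order all_algebra finmap.
From mathcomp Require Import monalg.
From mathcomp Require Import boolp.
Import Order.TTheory GRing.Theory Num.Theory.
Local Open Scope ring_scope.

Set Implicit Arguments.
Unset Strict Implicit.
Unset Printing Implicit Defensive.

(* A homogeneous map R(G, M) -> R_a(A) of degree c is the same as a linear map *)
(* f : M -> A with f(G_n) in a^(n+c) for all n, since multiplication by t^-1   *)
(* in R_a(A) is the inclusion. Hence degree c of the right hand side consists  *)
(* of the f with f(G_(nl)) in a^((n+c)l) for all n, and degree cl of the left  *)
(* hand side of those with f(G_n) in a^(n+cl) for all n. Regularity of x^*     *)
(* gives (a^(k+r) : x^r) = a^k, which makes the two conditions equivalent:     *)
(* the power of x bringing G_n into some G_(ql) can be cancelled.              *)

(** The isomorphism is handled as a relation: [dilate_compat phi psi] says that substituting t^l for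
    t intertwines [psi] with [phi]. It is compatible with sums and scalars, each side determines the
    other ([dilate_compat_inj], [dilate_compat_injr]), and every element of either module has a
    partner ([veronese_dilate_compat], [dilate_compat_veronese]), so it is the graph of a linear
    bijection. Partners are built degree by degree from the linear map [f] given by
    [homog_map_reesM]; the regular initial form enters through [initial_form_lreg_colonXz]. *)

Section LaurentMap.
Variables (V W : zmodType) (f : {additive V -> W}) (s : int -> int).

(** Used with [s] the shift by c, to extend a map M -> A to the Rees module, and with [f] the
    identity and [s] multiplication by l, for the substitution of t^l for t. *)
Definition lmap (u : laurent V) : laurent W :=
  \sum_(i <- msupp u) << f u@_i *g s i >>.

Lemma lmap_widen (d : {fset int}) u : (msupp u `<=` d)%fset ->
  lmap u = \sum_(i <- d) << f u@_i *g s i >>.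
Proof.
move=> le; rewrite /lmap (big_fset_incl _ le) //= => i _ /mcoeff_outdom ->.
by rewrite raddf0 monalgU0.
Qed.

Lemma lmapU i x : lmap << x *g i >> = << f x *g s i >>.
Proof. by rewrite (lmap_widen msuppU_le) big_seq_fset1 mcoeffUU. Qed.

Lemma lmapD : {morph lmap : u v / u + v}.
Proof.
move=> u v; pose d := (msupp u `|` msupp v)%fset.
rewrite (@lmap_widen d u) ?fsubsetUl // (@lmap_widen d v) ?fsubsetUr //.
rewrite (@lmap_widen d (u + v)) ?msuppD_le // -big_split; apply: eq_bigr => i _.
by rewrite mcoeffD raddfD monalgUD.
Qed.

Lemma lmap_coef_in (D : int -> {pred V}) (E : int -> {pred W}) u :
    (forall n, zmod_closed (E n)) ->
    (forall n x, x \in D n -> f x \in E (s n)) ->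
  u \in coef_in D -> lmap u \in coef_in E.
Proof.
move=> EB fE /coef_inP uD; have [E0 EBm] := coef_in_closed EB.
rewrite /lmap; elim/big_ind: _ => // [v w vE wE|i _].
  by rewrite -[w]opprK EBm // -sub0r EBm.
by apply: coef_inU; [move=> k; exact: (EB k).1 | exact: fE].
Qed.

End LaurentMap.

Lemma ipowz_le0 (A : comNzRingType) (I : {pred A}) n x : n <= 0 -> x \in ipowz I n.
Proof. by case: n => // -[]. Qed.

(** * Homogeneous maps from the Rees module to the Rees algebra *)

Section ReesModuleTheory.
Variables (A : comNzRingType) (I : {pred A}) (M : lmodType A) (G : filtration I M).

Definition reesMU n x (xG : x \in G n) : ext_rees_mod G :=
  ReesM (coef_inU (fun k => rpred0 (G k)) xG).

Lemma reesM_ind (P : ext_rees_mod G -> Prop) :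
  P 0 -> (forall u v, P u -> P v -> P (u + v)) ->
  (forall n x (xG : x \in G n), P (reesMU xG)) -> forall u, P u.
Proof.
move=> P0 PD PU u; move: (hdeg_sum u); move: u; apply: in_sum_ind => // n u.
move=> /reesM_degP[x ux].
have xG : x \in G n by have /coef_inP/(_ n) := reesMP u; rewrite [reesM_val u]ux mcoeffUU.
by have -> : u = reesMU xG by exact: val_inj.
Qed.

(** The power t^n itself, available in the Rees algebra because I^n = A for n <= 0. *)
Definition tinv n (n_le0 : n <= 0) : ext_rees I := reesU (ipowz_le0 I 1 n_le0).

Lemma tinv_reesMU n k x (nk : k - n <= 0) (xG : x \in G n) (xG' : x \in G k) :
  tinv nk *: reesMU xG = reesMU xG'.
Proof. by apply: val_inj; rewrite /= laurentUZ scale1r subrK. Qed.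

Lemma tinv_inj n (n_le0 : n <= 0) : injective ( *%R (tinv n_le0)).
Proof.
move=> f g /(congr1 val) /= fg; apply: val_inj.
(* t^n becomes a unit in A[t, 1/t]. *)
have := congr1 (fun h : laurent A => (<< 1 *g - n >> : laurent A) * h) fg.
by rewrite !mulrA laurentUM addNr mulr1 !mul1r.
Qed.

Section HomogMap.
Variables (f : {linear M -> A^o}) (c : int).
Hypothesis fG : forall n x, x \in G n -> f x \in ipowz I (n + c).

Definition reesM_map (u : ext_rees_mod G) : (ext_rees I)^o :=
  Rees (lmap_coef_in (ipowz_closed I) fG (reesMP u)).

Lemma reesM_map_homog : reesM_map \in homog_map c.
Proof.
apply/homog_mapP; split=> [r u v|n u /reesM_degP[x ux]]; last first.
  by apply/rees_degP; exists (f x); rewrite /= [reesM_val u]ux lmapU.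
apply: val_inj; rewrite /= lmapD; congr (_ + _).
(* Forgetting membership in the Rees objects lets both sides, biadditive in [r] and [u], be compared
   on monomials of the full Laurent modules. *)
move: (val r) (val u) => {}r {}u /=.
elim/laurent_ind: r => [i a|r r' IHr IHr']; last first.
  by rewrite scalerDl lmapD IHr IHr' [RHS]mulrDl.
elim/laurent_ind: u => [j x|u u' IHu IHu']; last first.
  by rewrite scalerDr !lmapD IHu IHu' [RHS]mulrDr.
by rewrite laurentUZ !lmapU [RHS]laurentUM addrA; congr << _ *g _ >>; exact: (linearZ_LR f).
Qed.

End HomogMap.

(* Compatibility with t^-1 forces all the components G_n -> I^(n+c) of a      *)
(* homogeneous map to be restrictions of the one where G_n = M.               *)
Lemma homog_map_reesM c (phi : ext_rees_mod G -> (ext_rees I)^o) :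
  phi \in homog_map c ->
  exists (f : {linear M -> A^o}) (fG : forall n x, x \in G n -> f x \in ipowz I (n + c)),
    phi = reesM_map fG.
Proof.
move=> /homog_mapP[phiL phiD].
have phiZ r u : phi (r *: u) = r * phi u.
  have phi0 : phi 0 = 0.
    have := phiL 1 0 0; rewrite !scale1r addr0 => /(congr1 (fun z => z - phi 0)).
    by rewrite addrK subrr.
  by rewrite -[r *: u]addr0 phiL phi0 addr0.
have phiA u v : phi (u + v) = phi u + phi v by rewrite -[u in LHS]scale1r phiL scale1r.
have phi_sub n k x (xGn : x \in G n) (xGk : x \in G k) : k <= n ->
    (val (phi (reesMU xGn)))@_(n + c) = (val (phi (reesMU xGk)))@_(k + c).
  move=> kn; have nk : k - n <= 0 by rewrite subr_le0.
  rewrite -(tinv_reesMU nk xGn xGk) phiZ.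
  have /rees_degP[b bE] : phi (reesMU xGn) \in hdeg (n + c).
    by apply: phiD; apply/reesM_degP; exists x.
  by rewrite /= [rees_val _]bE laurentUM mul1r addrA subrK !mcoeffUU.
(* In degree [n0] every element of M is available, so [f] is read off there; [phi_sub] then compares
   any other degree with [n0]. *)
have [n0 Gn0] := fil_low G.
have allG x : x \in G n0 by rewrite Gn0.
pose f x : A^o := (val (phi (reesMU (allG x))))@_(n0 + c).
have fL : linear f.
  move=> b x y; rewrite /f.
  have b0 : b \in ipowz I 0 by [].
  have -> : reesMU (allG (b *: x + y)) = reesU b0 *: reesMU (allG x) + reesMU (allG y).
    by apply: val_inj; rewrite /= laurentUZ add0r monalgUD.
  rewrite phiL /= mcoeffD; congr (_ + _).
  have /rees_degP[z zE] : phi (reesMU (allG x)) \in hdeg (n0 + c).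
    by apply: phiD; apply/reesM_degP; exists x.
  by rewrite [rees_val (phi _)]zE laurentUM add0r !mcoeffUU.
pose F : {linear M -> A^o} := HB.pack f (GRing.isLinear.Build A M A^o *:%R f fL).
have phiU n x (xG : x \in G n) : val (phi (reesMU xG)) = << f x *g n + c >>.
  have /rees_degP[b bE] : phi (reesMU xG) \in hdeg (n + c).
    by apply: phiD; apply/reesM_degP; exists x.
  suff <- : b = f x by [].
  have <- : (val (phi (reesMU xG)))@_(n + c) = b by rewrite bE mcoeffUU.
  by case: (leP n n0) => [le|/ltW le]; [symmetry|]; exact: phi_sub.
have fG n x : x \in G n -> F x \in ipowz I (n + c).
  move=> xG; have /coef_inP/(_ (n + c)) := reesP (phi (reesMU xG)).
  by rewrite [rees_val _]phiU mcoeffUU.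
exists F, fG; apply/funext; apply: reesM_ind => [|u v IHu IHv|n x xG].
- apply: (addrI (phi 0)); rewrite -phiA !addr0 /= -[LHS]addr0; congr (_ + _).
  by apply: val_inj; rewrite /= /lmap msupp0 big_seq_fset0.
- by rewrite phiA IHu IHv; apply: val_inj; rewrite /= lmapD.
- by apply: val_inj; rewrite [LHS]phiU /= lmapU.
Qed.

End ReesModuleTheory.

(** * Cancelling an element with regular initial form *)

Section InitialForm.
Variables (A : comNzRingType) (a : idealr A) (x : A) (xa : x \in a).
Hypothesis x_reg : GRing.lreg (initial_form xa).

(** By induction y is already in the power one below the target; its class in that graded piece is
    killed by the regular element x^*, hence zero, which gains the missing power. *)
Lemma initial_form_lreg_colon k y : x * y \in ipow a k.+1 -> y \in ipow a k.
Proof.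
elim: k => // k IHk xyI; have yI : y \in ipow a k by apply: IHk; exact: ipow_sub xyI.
pose Y : ext_rees a := @reesU _ _ (Posz k) y yI.
have x1 : x \in ipowz a 1 := etrans (ipow1 a x) xa.
have XY : reesU x1 * Y \in @gr_ideal A a.
  apply/gr_idealP => n; rewrite /= laurentUM mcoeffU.
  by case: eqP => [<-|_]; [rewrite -!PoszD add1n addn1 | exact: ipowz0].
have pi_eq0 (F : ext_rees a) :
    (\pi_({ideal_quot (@gr_ideal A a)}) F = 0 :> assoc_graded a)%qT <-> F \in @gr_ideal A a.
  rewrite -[F in F \in _]subr0 Quotient.idealrBE.
  by rewrite -[0 in X in X <-> _](rmorph0 (\pi_({ideal_quot (@gr_ideal A a)}))%qT); split=> /eqP.
suff /pi_eq0 : (\pi_({ideal_quot (@gr_ideal A a)}) Y)%qT = 0 :> assoc_graded a.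
  by move=> /gr_idealP/(_ (Posz k)); rewrite mcoeffUU -PoszD addn1.
apply: x_reg; rewrite mulr0 -[LHS](rmorphM (\pi_({ideal_quot (@gr_ideal A a)}))%qT).
exact/pi_eq0.
Qed.

Lemma initial_form_lreg_colonXz (r : nat) k y :
  x ^+ r * y \in ipowz a (k + r%:Z) -> y \in ipowz a k.
Proof.
elim: r k y => [|r IHr] k y; first by rewrite mul1r addr0.
rewrite exprSr -mulrA -addn1 PoszD [r%:Z + _]addrC addrA => /IHr.
(* For negative [k] the target is all of A. *)
case: k => [k|k] //; rewrite -PoszD addn1; exact: initial_form_lreg_colon.
Qed.

End InitialForm.

(** * Linearity of elements of the graded Hom *)

Section StarHomTheory.
Variables (R : gradedRingType) (U V : gradedModType R).

Lemma star_homD (phi : star_hom U V) u v : phi (u + v) = phi u + phi v.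
Proof. by have := star_hom_linear phi 1 u v; rewrite !scale1r. Qed.

Lemma star_hom0 (phi : star_hom U V) : phi 0 = 0.
Proof. by apply: (addrI (phi 0)); rewrite -star_homD !addr0. Qed.

Lemma star_homZ (phi : star_hom U V) r u : phi (r *: u) = r *: phi u.
Proof. by rewrite -[r *: u]addr0 star_hom_linear star_hom0 addr0. Qed.

Lemma homog_star_hom c (phi : U -> V) : phi \in homog_map c -> phi \in @star_hom_pred R U V.
Proof. by move=> phic; apply/asboolP; apply: (in_sum1 (@homog_map_closed R U V)) phic. Qed.

End StarHomTheory.

(** * The correspondence between the two graded Hom modules *)

Section Transfer.
Variables (A : comNzRingType) (I : {pred A}) (M : lmodType A) (G : filtration I M).
Variables (l : nat) (l0 : (0 < l)%N).

Notation Gl := (veronese_fil G l0).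
Notation homR := (star_hom (ext_rees_mod G) (ext_rees I)^o).
Notation homRl := (star_hom (ext_rees_mod Gl) (ext_rees (ipow I l))^o).

Lemma reesM_dilate_in (u : ext_rees_mod Gl) :
  lmap idfun ( *%R^~ l%:Z) (val u) \in coef_in (fun n => G n : {pred M}).
Proof.
apply: (lmap_coef_in _ _ (reesMP u)) => // n.
by split; [exact: rpred0 | move=> x y xG yG; rewrite rpredD // -scaleN1r rpredZ].
Qed.

Definition reesM_dilate (u : ext_rees_mod Gl) : ext_rees_mod G := ReesM (reesM_dilate_in u).

Lemma reesM_dilateU n x (xG : x \in Gl n) :
  reesM_dilate (reesMU xG) = @reesMU _ _ _ G (n * l%:Z) x xG.
Proof. by apply: val_inj; rewrite /= lmapU. Qed.

Definition dilate_compat (phi : homR) (psi : homRl) : Prop :=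
  forall u, rees_dilate (psi u) = phi (reesM_dilate u).

Lemma rees_dilate_inj : injective (@rees_dilate A I l).
Proof.
move=> f g fg; apply: (bij_inj (rees_veronese_bij I l0)); exact: val_inj.
Qed.

Lemma rees_dilate0 : rees_dilate (0 : ext_rees (ipow I l)) = 0.
Proof. exact: (congr1 val (raddf0 (rees_veronese I l))). Qed.

Lemma rees_dilateM (f g : ext_rees (ipow I l)) :
  rees_dilate (f * g) = rees_dilate f * rees_dilate g.
Proof. by apply: val_inj; exact: dilateM. Qed.

Lemma dilate_compat0 : dilate_compat 0 0.
Proof. by move=> u; exact: rees_dilate0. Qed.

Lemma dilate_compatD phi phi' psi psi' :
  dilate_compat phi psi -> dilate_compat phi' psi' ->
  dilate_compat (phi + phi') (psi + psi').
Proof. by move=> pp pp' u; rewrite /= rees_dilateD pp pp'. Qed.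

Lemma dilate_compatZ (r : ext_rees (ipow I l)) phi psi :
  dilate_compat phi psi -> dilate_compat (rees_dilate r *: phi) (r *: psi).
Proof. by move=> pp u; rewrite /= rees_dilateM pp. Qed.

(** Both maps apply the same [f] to coefficients, and the exponents agree since (n + c)l = nl +
    cl. *)
Lemma dilate_compat_homog (f : {linear M -> A^o}) c
    (fG : forall n x, x \in G n -> f x \in ipowz I (n + c * l%:Z))
    (fGl : forall n x, x \in Gl n -> f x \in ipowz (ipow I l) (n + c)) :
  dilate_compat (StarHom (homog_star_hom (reesM_map_homog fG)))
    (StarHom (homog_star_hom (reesM_map_homog fGl))).
Proof.
move=> u; apply: val_inj => /=; move: (val u) => {}u /=.
elim/laurent_ind: u => [n x|u v IHu IHv]; last by rewrite !(lmapD, dilateD) IHu IHv.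
by rewrite !lmapU dilateU mulrDl.
Qed.

Lemma dilate_compat_inj phi psi psi' :
  dilate_compat phi psi -> dilate_compat phi psi' -> psi = psi'.
Proof.
move=> pp pp'; apply: val_inj; apply/funext => u; apply: rees_dilate_inj.
by rewrite [LHS]pp [RHS]pp'.
Qed.

(* t^-r carries G_n t^n into the dilated degrees, and is a nonzerodivisor.     *)
Lemma dilate_compat_injr phi phi' psi :
  dilate_compat phi psi -> dilate_compat phi' psi -> phi = phi'.
Proof.
move=> pp pp'; apply: val_inj; apply/funext; apply: reesM_ind => [|u v IHu IHv|n x xG].
- by rewrite /= !star_hom0.
- by rewrite /= !star_homD; congr (_ + _).
(* The floor gives ql <= n, so [x] also lies in G_(ql), a component reached by the dilation. *)
pose q := (n %/ l%:Z)%Z.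
have qn : q * l%:Z - n <= 0.
  by rewrite subr_le0 lez_floor //; case: l l0.
have xGq : x \in G (q * l%:Z) by apply: fil_sub xG; rewrite -subr_le0.
apply: (@tinv_inj A I _ qn).
rewrite -![tinv I qn * _]star_homZ (tinv_reesMU qn xG xGq) -(@reesM_dilateU q x xGq).
by rewrite -pp -pp'.
Qed.

(** In degree cl, the condition on [f] at the indices nl alone is the condition for degree c over
    the Veronese filtration, because (I^l)^(n+c) = I^((n+c)l). *)
Lemma veronese_dilate_compat (phi : homR) :
  phi \in veronese_pred l homR -> exists psi, dilate_compat phi psi.
Proof.
move: phi; apply: ver_ind => [|phi phi' [psi pp] [psi' pp']|c phi].
- by exists 0; exact: dilate_compat0.
- by exists (psi + psi'); exact: dilate_compatD.
move=> /homog_map_reesM[f [fG phiE]].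
have fGl n x : x \in Gl n -> f x \in ipowz (ipow I l) (n + c).
  by move=> /fG fxI; rewrite -mulrDl in fxI; exact: etrans (ipowzM I _ l0 (f x)) fxI.
exists (StarHom (homog_star_hom (reesM_map_homog fGl))).
suff -> : phi = StarHom (homog_star_hom (reesM_map_homog fG)) by exact: dilate_compat_homog.
exact: val_inj.
Qed.

(* For y in G_n take q = ceil(n / l): then x^(ql-n) y lies in G_(ql), so that  *)
(* x^(ql-n) f(y) lies in I^(ql+cl), and x can be cancelled.                    *)
Lemma dilate_compat_veronese x : x \in I ->
    (forall r (k : int) y, x ^+ r * y \in ipowz I (k + r%:Z) -> y \in ipowz I k) ->
  forall psi : homRl, exists phi, phi \in veronese_pred l homR /\ dilate_compat phi psi.
Proof.
move=> xI colon psi; have := hdeg_sum psi; move: psi.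
apply: in_sum_ind => [|psi psi' [phi [phiV pp]] [phi' [phiV' pp']]|c psi].
- by exists 0; split; [exact: (ver_closed _ _).1 | exact: dilate_compat0].
- by exists (phi + phi'); split; [exact: verD | exact: dilate_compatD].
move=> /homog_map_reesM[f [fGl psiE]].
have xr r : x ^+ r \in ipow I r.
  by elim: r => // r IHr; rewrite exprS; exact: (@smul_mem _ A^o).
have fG n y : y \in G n -> f y \in ipowz I (n + c * l%:Z).
  move=> yG; pose q : int := - (- n %/ l%:Z)%Z.
  have nq : n <= q * l%:Z by rewrite mulNr lerNr lez_floor //; case: l l0.
  pose r := absz (q * l%:Z - n)%R.
  have rE : r%:Z = q * l%:Z - n by rewrite gez0_abs ?subr_ge0.
  apply: (colon r).
  have -> : n + c * l%:Z + r%:Z = (q + c) * l%:Z by rewrite rE mulrDl addrAC [n + _]addrC subrK.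
  have <- : f (x ^+ r *: y) = x ^+ r * f y by exact: (linearZ_LR f).
  apply: (etrans (esym (ipowzM I _ l0 (f _)))); refine (fGl q _ _).
  change (x ^+ r *: y \in G (q * l%:Z)).
  by rewrite -[q * _](subrK n) -rE; apply: fil_ipowz.
exists (StarHom (homog_star_hom (reesM_map_homog fG))); split.
  by apply: (@ver_hdeg _ _ c); exact: reesM_map_homog.
suff -> : psi = StarHom (homog_star_hom (reesM_map_homog fGl)) by exact: dilate_compat_homog.
exact: val_inj.
Qed.

End Transfer.

Theorem theorem1p4 (A : comNzRingType) (m : idealr A) (d : nat) (a : idealr A)
    (M : lmodType A) (G : filtration a M) :
  noetherian A ->
  local_ring m ->
  has_depth m d -> (2 <= d)%N ->
  m_primary m a ->
  fin_gen (predT : {pred M}) ->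
  stable G ->
  (forall n : int, n <= 0 -> G n =i predT) ->
  ~ (G 1 =i predT) ->
  (exists (x : A) (xa : x \in a),
     x \notin ipow a 2 /\ GRing.lreg (initial_form xa)) ->
  forall (l : nat) (l_gt0 : (0 < l)%N),
  exists f : {linear
      restrict_scalars (rees_veronese a l)
        (veronese l (star_hom (ext_rees_mod G) (ext_rees a)^o)) ->
      star_hom (ext_rees_mod (veronese_fil G l_gt0)) (ext_rees (ipow a l))^o},
    bijective f.
Proof.
move=> _ _ _ _ _ _ _ _ _ [x [xa [_ x_reg]]] l l0.
pose hom := star_hom (ext_rees_mod G) (ext_rees a)^o.
pose ver := restrict_scalars (rees_veronese a l) (veronese l hom).
pose hom' := star_hom (ext_rees_mod (veronese_fil G l0)) (ext_rees (ipow a l))^o.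
have /choice[f fP] : forall phi : ver, exists psi : hom', dilate_compat (ver_val phi) psi.
  by move=> phi; exact: veronese_dilate_compat (verP phi).
have /choice[g gP] : forall psi : hom', exists phi : ver, dilate_compat (ver_val phi) psi.
  move=> psi; have [phi [phiV pp]] :=
    dilate_compat_veronese xa (initial_form_lreg_colonXz x_reg) psi.
  by exists (Ver phiV).
(* The chosen [f] is linear because both sides are partners of the same element, and partners are
   unique. *)
have fL : linear f.
  move=> r phi phi'; apply: dilate_compat_inj (fP _) _.
  by apply: dilate_compatD (fP _); exact: dilate_compatZ.
pose F : {linear ver -> hom'} :=
  HB.pack f (GRing.isLinear.Build (ext_rees (ipow a l)) ver hom' *:%R f fL).
exists F; exists g => [phi|psi] /=.
  by apply: val_inj; exact: dilate_compat_injr (gP _) (fP _).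
exact: dilate_compat_inj (fP _) (gP _).
Qed.
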